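(* Let $\mathcal A$ and $\mathcal B$ be countable structures with domain $\omega$. For every continuous group isomorphism $H\colon\mathrm{Aut}(\mathcal B)\to\mathrm{Aut}(\mathcal A)$ there is a Borel adjoint equivalence of categories $(F,G,\eta,\epsilon)$ with $F\colon\mathrm{Iso}(\mathcal B)\to\mathrm{Iso}(\mathcal A)$, such that $F(\mathcal B)=\mathcal A$ and the restriction of $F$ to $\mathrm{Aut}(\mathcal B)$ is $H$.
   Context: $\mathrm{Iso}(\mathcal A)$ is the category of structures with domain $\omega$ isomorphic to $\mathcal A$, with isomorphisms as morphisms; functors preserve identities and compositions. An adjoint equivalence consists of functors $F\colon\mathrm{Iso}(\mathcal B)\to\mathrm{Iso}(\mathcal A)$, $G\colon\mathrm{Iso}(\mathcal A)\to\mathrm{Iso}(\mathcal B)$ and natural isomorphisms $\epsilon_{\tilde{\mathcal A}}\colon\tilde{\mathcal A}\to F(G(\tilde{\mathcal A}))$, $\eta_{\tilde{\mathcal B}}\colon\tilde{\mathcal B}\to G(F(\tilde{\mathcal B}))$ (naturality: $G(F(h))\circ\eta_{\hat{\mathcal B}}=\eta_{\tilde{\mathcal B}}\circ h$ for isomorphisms $h\colon\hat{\mathcal B}\to\tilde{\mathcal B}$, similarly for $\epsilon$) satisfying $F(\eta_{\hat{\mathcal B}})=\epsilon_{F(\hat{\mathcal B})}$ and $G(\epsilon_{\hat{\mathcal A}})=\eta_{G(\hat{\mathcal A})}$; it is Borel if $F,G,\eta,\epsilon$ are given by Borel operators on reals (structures and maps coded as reals). Automorphism groups carry the pointwise convergence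 topology. *)

(* Defs.v *)
From HB Require Import structures.
From mathcomp Require Import all_boot all_order all_algebra.
From mathcomp Require Import all_classical all_reals all_analysis.

Set Implicit Arguments.
Unset Strict Implicit.
Unset Printing Implicit Defensive.

Local Open Scope classical_set_scope.

(* The reals of the theory are the points of Baire space. *)
Definition baire : Type := {ptws nat -> nat}.
HB.instance Definition _ := Topological.copy baire {ptws nat -> nat}.

Definition borel_set (X : topologicalType) : set (set X) := <<s @open X >>.

Definition borel_operator (X Y : topologicalType) (f : X -> Y) : Prop :=
  forall U : set Y, borel_set U -> borel_set (f @^-1` U).

Record language := Language {
  rel_symbol : countType;
  rel_arity : rel_symbol -> nat;
  fun_symbol : countType;
  fun_arity : fun_symbol -> nat }.

Record structure (L : language) := Structure {
  rel_interp : forall r : rel_symbol L, (rel_arity r).-tuple nat -> bool;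
  fun_interp : forall f : fun_symbol L, (fun_arity f).-tuple nat -> nat }.

(* [inl (r; t)] is the sentence r(t), and [inr (f; (t, y))] is f(t) = y. *)
Definition atomic (L : language) : countType :=
  ({r : rel_symbol L & (rel_arity r).-tuple nat} +
   {f : fun_symbol L & ((fun_arity f).-tuple nat * nat)%type})%type.

Definition satisfies (L : language) (M : structure L) (p : atomic L) : bool :=
  match p with
  | inl s => rel_interp M (tagged s)
  | inr s => fun_interp M (tagged s).1 == (tagged s).2
  end.

(* The atomic diagram, as the characteristic function of a set of codes. *)
Definition diagram (L : language) (M : structure L) : baire := fun n =>
  if @unpickle (atomic L) n is Some p then nat_of_bool (satisfies M p) else 0.

Definition is_iso (L : language) (M N : structure L) (h : nat -> nat) : Prop :=
  [/\ bijective h,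
      forall (r : rel_symbol L) (t : (rel_arity r).-tuple nat),
        rel_interp N (map_tuple h t) = rel_interp M t
    & forall (f : fun_symbol L) (t : (fun_arity f).-tuple nat),
        fun_interp N (map_tuple h t) = h (fun_interp M t)].

(* As a [set_type], this carries the topology of pointwise convergence. *)
Definition iso (L : language) (M N : structure L) :=
  set_type ([set h | is_iso M N h] : set baire).
HB.instance Definition _ (L : language) (M N : structure L) :=
  Topological.on (iso M N).

Definition iso_fun (L : language) (M N : structure L) (h : iso M N) : baire :=
  \val h.
Coercion iso_fun : iso >-> baire.

Notation aut M := (iso M M).

Lemma is_iso_id (L : language) (M : structure L) : is_iso M M id.
Proof.
split=> [|r t|f t]; first by exists id.
- by congr rel_interp; apply: val_inj; rewrite /= map_id.
- by congr fun_interp; apply: val_inj; rewrite /= map_id.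
Qed.

Lemma is_iso_comp (L : language) (M N P : structure L) (g h : nat -> nat) :
  is_iso N P g -> is_iso M N h -> is_iso M P (g \o h).
Proof.
move=> [bg rg fg] [bh rh fh]; split=> [|r t|f t]; first exact: bij_comp.
- rewrite -rh -rg; congr rel_interp.
  by apply: val_inj; rewrite /= map_comp.
- rewrite /= -fh -fg; congr fun_interp.
  by apply: val_inj; rewrite /= map_comp.
Qed.

Lemma isoP (L : language) (M N : structure L) (h : iso M N) : is_iso M N (h : baire).
Proof. exact: (set_mem (valP h)). Qed.

Definition Iso_of (L : language) (M N : structure L) (h : nat -> nat)
    (hP : is_iso M N h) : iso M N :=
  exist _ (h : baire) (mem_set hP).

Definition iso_id (L : language) (M : structure L) : aut M :=
  Iso_of (is_iso_id M).

Definition iso_comp (L : language) (M N P : structure L)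
    (g : iso N P) (h : iso M N) : iso M P :=
  Iso_of (is_iso_comp (isoP g) (isoP h)).

Definition group_isomorphism (LA LB : language) (A : structure LA)
    (B : structure LB) (H : aut B -> aut A) : Prop :=
  bijective H /\ {morph H : g h / iso_comp g h >-> iso_comp g h}.

Record copy (L : language) (A : structure L) := Copy {
  copy_structure :> structure L;
  copy_iso : exists h, is_iso A copy_structure h }.

Definition self_copy (L : language) (A : structure L) : copy A :=
  Copy (ex_intro _ id (is_iso_id A)).

Record functor (LA LB : language) (B : structure LB) (A : structure LA) :=
  Functor {
    fobj :> copy B -> copy A;
    fmor : forall M N : copy B, iso M N -> iso (fobj M) (fobj N);
    fmor_id : forall M : copy B, fmor (iso_id M) = iso_id (fobj M);
    fmor_comp : forall (M N P : copy B) (g : iso N P) (h : iso M N),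
      fmor (iso_comp g h) = iso_comp (fmor g) (fmor h) }.

Record adjoint_equivalence (LA LB : language)
    (B : structure LB) (A : structure LA) := AdjointEquivalence {
  eqF : functor B A;
  eqG : functor A B;
  eqepsilon : forall M : copy A, iso M (eqF (eqG M));
  eqeta : forall M : copy B, iso M (eqG (eqF M));
  eqepsilon_natural : forall (M N : copy A) (h : iso M N),
    iso_comp (fmor eqF (fmor eqG h)) (eqepsilon M) = iso_comp (eqepsilon N) h;
  eqeta_natural : forall (M N : copy B) (h : iso M N),
    iso_comp (fmor eqG (fmor eqF h)) (eqeta M) = iso_comp (eqeta N) h;
  eqF_eta : forall M : copy B, fmor eqF (eqeta M) = eqepsilon (eqF M);
  eqG_epsilon : forall M : copy A, fmor eqG (eqepsilon M) = eqeta (eqG M) }.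

Definition borel_functor (LA LB : language) (B : structure LB)
    (A : structure LA) (F : functor B A) : Prop :=
  (exists2 Phi : baire -> baire, borel_operator Phi &
     forall M : copy B, Phi (diagram M) = diagram (F M)) /\
  (exists2 Phi : baire * baire * baire -> baire, borel_operator Phi &
     forall (M N : copy B) (h : iso M N),
       Phi (diagram M, h : baire, diagram N) = fmor F h).

Definition borel_transformation (L : language) (A : structure L)
    (T : copy A -> copy A) (t : forall M : copy A, iso M (T M)) : Prop :=
  exists2 Psi : baire -> baire, borel_operator Psi &
    forall M : copy A, Psi (diagram M) = t M.

Definition borel_adjoint_equivalence (LA LB : language) (B : structure LB)
    (A : structure LA) (E : adjoint_equivalence B A) : Prop :=
  [/\ borel_functor (eqF E), borel_functor (eqG E),
      borel_transformation (eqepsilon E) & borel_transformation (eqeta E)].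

(* Main.v *)
(* The functor F can be taken constant on objects.  Suppose b_M : B -> M is an
   isomorphism depending in a Borel way on the copy M of B, with b_B = id.
   Then F(M) = A and F(h : M -> N) = H(b_N^-1 h b_M) define a functor extending
   H; likewise G(M) = B and G(h) = H^-1(a_N^-1 h a_M), and the inverses of a_M
   and b_M are the components of an adjoint equivalence.

   Both the Borel choice of b_M and the Borelness of H^-1 (whose continuity is
   not assumed) follow from Lusin's separation argument: if two analytic sets
   were not Borel separable, a sequence of shrinking non-separable cylinders
   would converge to two points with the same image.  For H^-1 the sets are the
   H-images of {g | g n = m} and its complement.  For b_M they are the diagrams
   of the copies M of B for which some isomorphism B -> M has a given finite
   initial part, resp. none has; b_M is then the leftmost branch of the tree of
   these initial parts, made the identity at B by composing with b_B^-1. *)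

Require Import Defs.
From mathcomp Require Import all_boot all_order all_algebra.
From mathcomp Require Import all_classical all_reals all_analysis.

Set Implicit Arguments.
Unset Strict Implicit.
Unset Printing Implicit Defensive.

Local Open Scope classical_set_scope.

(** * Finite agreement of sequences, dependent choice, least witnesses *)

Definition agree (T : Type) (k : nat) (x y : nat -> T) : Prop :=
  forall i, i < k -> x i = y i.

Lemma agreeW (T : Type) (j k : nat) (x y : nat -> T) :
  j <= k -> agree k x y -> agree j x y.
Proof. by move=> jk xy i ij; apply/xy/(leq_trans ij). Qed.

Lemma agree_sym (T : Type) (k : nat) (x y : nat -> T) :
  agree k x y -> agree k y x.
Proof. by move=> xy i /xy. Qed.

Lemma agree_mkseq (T : Type) (k : nat) (x y : nat -> T) :
  agree k x y <-> mkseq x k = mkseq y k.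
Proof.
split=> [xy|xy i ik].
  by apply/eq_in_map => i; rewrite mem_iota => /xy.
by rewrite -(nth_mkseq (x 0) x ik) xy nth_mkseq.
Qed.

Definition greedy (T : Type) (f : seq T -> T) (n : nat) : seq T :=
  iter n (fun s => rcons s (f s)) [::].

Lemma greedyE (T : Type) (f : seq T -> T) (n : nat) :
  greedy f n = mkseq (fun i => f (greedy f i)) n.
Proof. by elim: n => // n IH; rewrite mkseqS -IH. Qed.

Lemma dependent_choice (T : Type) (Q : seq T -> Prop) :
  Q [::] -> (forall s, Q s -> exists a, Q (rcons s a)) ->
  exists x, forall n, Q (mkseq x n).
Proof.
move=> Q0 QS; have [a0 _] := QS _ Q0.
have /choice[f fP] s : exists a, Q s -> Q (rcons s a).
  have [/QS[a Qa]|nQ] := pselect (Q s); first by exists a.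
  by exists a0.
exists (fun n => f (greedy f n)) => n.
by rewrite -greedyE; elim: n => //= n; apply: fP.
Qed.

(** The default 0 makes this total, so that applied to a sequence of Borel sets it gives a Borel
    function on the whole space. *)
Definition least (Q : nat -> Prop) : nat :=
  xget 0 [set n | Q n /\ forall m, m < n -> ~ Q m].

Lemma least_min (Q : nat -> Prop) :
  (exists n, Q n) -> Q (least Q) /\ forall m, m < least Q -> ~ Q m.
Proof.
move=> [n Qn]; rewrite /least; case: xgetP => [m _ //|noleast].
suff nQ m : ~ Q m by have := nQ n Qn.
by elim/ltn_ind: m => m IH Qm; apply: (noleast m); split.
Qed.

Lemma leastP (Q : nat -> Prop) : (exists n, Q n) -> Q (least Q).
Proof. by move/least_min => []. Qed.

Lemma least_eq (Q : nat -> Prop) (n : nat) :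
  least Q = n <->
  (Q n /\ forall m, m < n -> ~ Q m) \/ (n = 0 /\ forall m, ~ Q m).
Proof.
split=> [<-|[[Qn nQ]|[-> nQ]]].
- have [/least_min|/forallNP nQ] := pselect (exists n, Q n); first by left.
  by right; split => //; rewrite /least; case: xgetP => // m _ [/nQ].
- have [Ql nQl] := least_min (ex_intro _ n Qn).
  by case: (ltngtP (least Q) n) => // [/nQ|/nQl].
- by rewrite /least; case: xgetP => // m _ [/nQ].
Qed.

(** * Borel sets and Borel functions *)

Section borel.
Context {X : topologicalType}.
Implicit Types (U : set X).

Lemma borel_open U : open U -> borel_set U.
Proof. exact: sub_sigma_algebra. Qed.

Lemma borel_setC U : borel_set U -> borel_set (~` U).
Proof. by rewrite -setTD; exact: sigma_algebraCD. Qed.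

Lemma borel_set0 : borel_set (set0 : set X).
Proof. exact: sigma_algebra0. Qed.

Lemma borel_setT : borel_set (setT : set X).
Proof. by have := borel_setC borel_set0; rewrite setC0. Qed.

Lemma borel_bigcup (I : countType) (U : I -> set X) :
  (forall i, borel_set (U i)) -> borel_set (\bigcup_i U i).
Proof.
move=> bU; rewrite (_ : \bigcup_i U i =
    \bigcup_n (if unpickle n is Some i then U i else set0)).
  by apply: sigma_algebra_bigcup => n; case: unpickle => // *; exact: borel_set0.
apply/seteqP; split=> x [].
  by move=> i _ Ux; exists (pickle i); rewrite //= pickleK.
by move=> n _; case: unpickle => // i Ux; exists i.
Qed.

Lemma borel_bigcap (I : countType) (U : I -> set X) :
  (forall i, borel_set (U i)) -> borel_set (\bigcap_i U i).
Proof.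
move=> bU; rewrite -(setCK (\bigcap_i _)) setC_bigcap; apply: borel_setC.
by apply: borel_bigcup => i; exact: borel_setC.
Qed.

Lemma borel_setU U V : borel_set U -> borel_set V -> borel_set (U `|` V).
Proof.
move=> bU bV; rewrite -bigcup2E; apply: borel_bigcup => -[|[|?]] //=.
exact: borel_set0.
Qed.

Lemma borel_setI U V : borel_set U -> borel_set V -> borel_set (U `&` V).
Proof.
move=> bU bV; rewrite -(setCK (U `&` V)) setCI; apply: borel_setC.
by apply: borel_setU; exact: borel_setC.
Qed.

Lemma borel_if (b : Prop) U : borel_set U -> borel_set [set x | b /\ U x].
Proof.
move=> bU; have [Pb|nPb] := pselect b.
  by rewrite (_ : mkset _ = U) //; apply/seteqP; split=> x //= [].
rewrite (_ : mkset _ = set0); first exact: borel_set0.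
by apply/seteqP; split=> x //= [].
Qed.

Lemma borel_imp (b : Prop) U : borel_set U -> borel_set [set x | b -> U x].
Proof.
move=> bU; have [Pb|nPb] := pselect b.
  by rewrite (_ : mkset _ = U) //; apply/seteqP; split=> x //=; apply.
rewrite (_ : mkset _ = setT); first exact: borel_setT.
by apply/seteqP; split=> x //= _ /nPb.
Qed.

(** Meant for countable [C], where Borel fibres make every preimage Borel; numbers and finite
    sequences are then treated alike. *)
Definition borel_fun (C : Type) (f : X -> C) : Prop :=
  forall c, borel_set [set x | f x = c].

Lemma borel_fun_cst (C : Type) (c : C) : borel_fun (fun=> c).
Proof.
move=> d; rewrite (_ : mkset _ = [set x | c = d /\ setT x]).
  by apply: borel_if; exact: borel_setT.
by apply/seteqP; split=> x // [].
Qed.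

(** The countably many fibres of [f] are Borel, and on each of them the first argument of [g] is
    constant. *)
Lemma borel_fun_bind (C : countType) (D : Type) (f : X -> C) (g : C -> X -> D) :
  borel_fun f -> (forall c, borel_fun (g c)) -> borel_fun (fun x => g (f x) x).
Proof.
move=> bf bg d; rewrite (_ : mkset _ =
    \bigcup_c ([set x | f x = c] `&` [set x | g c x = d])).
  by apply: borel_bigcup => c; apply: borel_setI; [exact: bf|exact: bg].
by apply/seteqP; split=> x => [gd|[c _ [/= <-]]] //; exists (f x).
Qed.

Lemma borel_fun_comp (C : countType) (D : Type) (f : X -> C) (g : C -> D) :
  borel_fun f -> borel_fun (fun x => g (f x)).
Proof.
by move=> bf; apply: (@borel_fun_bind _ _ f (fun c _ => g c)) => // c;
  exact: borel_fun_cst.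
Qed.

Lemma borel_least (V : nat -> set X) :
  (forall n, borel_set (V n)) -> borel_fun (fun x => least (fun n => V n x)).
Proof.
move=> bV n; rewrite (_ : mkset _ =
    (V n `&` \bigcap_m [set x | m < n -> ~ V m x]) `|`
    [set x | n = 0 /\ (\bigcap_m ~` V m) x]).
  apply: borel_setU.
    apply: borel_setI => //; apply: borel_bigcap => m.
    by apply: (@borel_imp _ (~` V m)); exact: borel_setC.
  by apply: borel_if; apply: borel_bigcap => m; apply: borel_setC.
apply/seteqP; split=> x.
  move/least_eq => [[Vn nV]|[n0 nV]]; last by right; split => // m _; exact: nV.
  by left; split=> // m _; exact: nV.
move=> H; apply/least_eq; case: H => [[Vn nV]|[n0 nV]].
  by left; split=> // m; exact: nV.
by right; split => // m; exact: nV.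
Qed.

End borel.

Lemma borel_operator_open (X Y : topologicalType) (f : X -> Y) :
  (forall U, open U -> borel_set (f @^-1` U)) -> borel_operator f.
Proof.
move=> fo; suff: @borel_set Y `<=` [set V | borel_set (f @^-1` V)] by [].
apply: smallest_sub => //; split=> /= [|V bV|V bV].
- by rewrite preimage_set0; exact: borel_set0.
- by rewrite setTD preimage_setC; exact: borel_setC.
- by rewrite preimage_bigcup; exact: borel_bigcup.
Qed.

Lemma continuous_borel (X Y : topologicalType) (f : X -> Y) :
  continuous f -> borel_operator f.
Proof.
by move=> /continuousP fc; apply: borel_operator_open => U /fc/borel_open.
Qed.

Lemma borel_fun_preimage (X Y : topologicalType) (C : Type) (f : X -> Y)
    (g : Y -> C) :
  borel_operator f -> borel_fun g -> borel_fun (fun x => g (f x)).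
Proof. by move=> bf bg c; exact: (bf _ (bg c)). Qed.

(** * Cylinders and Borel maps into Baire space *)

Lemma continuous_eval (n : nat) : continuous (fun x : baire => x n).
Proof. exact: (@proj_continuous nat (fun=> nat) n). Qed.

Lemma open_eval (n m : nat) : open [set x : baire | x n = m].
Proof.
have /continuousP/(_ [set m]) := @continuous_eval n; apply.
exact: discrete_open.
Qed.

Lemma borel_eval (n : nat) : borel_fun (fun x : baire => x n).
Proof. by move=> m; apply: borel_open; exact: open_eval. Qed.

(** Otherwise points outside [V] that agree with [x] ever further would converge to [x]. *)
Lemma open_agree (V : set baire) (x : baire) :
  open V -> V x -> exists k, forall y : baire, agree k y x -> V y.
Proof.
move=> oV Vx; apply: contrapT => /forallNP noV.
have /choice[g gP] k : exists y : baire, agree k y x /\ ~ V y.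
  by have /existsNP[y /not_implyP[]] := noV k; exists y.
have gx : g @ \oo --> x.
  apply/cvg_sup => N U [W] [[W' oW' <-] Wx WU].
  by apply: (filterS WU); exists N.+1 => // i /= Ni; rewrite /proj (gP i).1.
have /gx[N _ /(_ N (leqnn N))] : nbhs x V by exact: open_nbhs_nbhs.
by case: (gP N).
Qed.

(** An open set is the union of the countably many cylinders inside it, and a cylinder constrains
    finitely many coordinates. *)
Lemma borel_operator_baire (X : topologicalType) (f : X -> baire) :
  (forall n, borel_fun (fun x => f x n)) -> borel_operator f.
Proof.
move=> bf; apply: borel_operator_open => U oU.
pose cyl (s : seq nat) := [set y : baire | mkseq y (size s) = s].
rewrite (_ : _ @^-1` _ = \bigcup_s [set x | cyl s `<=` U /\
    (\bigcap_i [set x | i < size s -> f x i = nth 0 s i]) x]).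
  apply: borel_bigcup => s; apply: borel_if; apply: borel_bigcap => i.
  by apply: (@borel_imp _ _ [set x | f x i = nth 0 s i]); exact: bf.
apply/seteqP; split=> x /= => [Ufx|[s _ [sU]]].
  have [k kU] := open_agree oU Ufx.
  exists (mkseq (f x) k) => //; split=> [y|i _].
    by rewrite /cyl /= size_mkseq => /agree_mkseq/kU.
  by rewrite /= size_mkseq => ik; rewrite nth_mkseq.
move=> fs; apply: sU; rewrite /cyl /=.
apply: (@eq_from_nth _ 0); rewrite size_mkseq // => i ik.
by rewrite nth_mkseq // fs.
Qed.

(** * Borel separation *)

(** The hypotheses say in turn: [p] has closed range in the sequences over [K], [f] is continuous
    for the topology pulled back along [p], [P] is clopen in it, and [P] is a union of fibres of
    [f]. So [P] and its complement have disjoint analytic images, which [R] separates. *)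
Lemma lusin_separation (K : countType) (T : Type) (p : T -> nat -> K)
    (f : T -> baire) (P : T -> Prop) :
  (forall x, (forall k, exists t, agree k (p t) x) -> exists t, p t = x) ->
  (forall t n, exists k, forall t', agree k (p t') (p t) -> f t' n = f t n) ->
  (forall t, exists k, forall t', agree k (p t') (p t) -> (P t' <-> P t)) ->
  (forall t t', f t = f t' -> P t -> P t') ->
  exists2 R, borel_set R & forall t, R (f t) <-> P t.
Proof.
move=> complete fcont Pcont Pf.
(* The first components of [s] fix a cylinder for the points in [P], the second components one for
   the points outside. *)
pose sep (s : seq (K * K)) := exists R, [/\ borel_set R,
  forall t, P t -> mkseq (p t) (size s) = unzip1 s -> R (f t) &
  forall t, ~ P t -> mkseq (p t) (size s) = unzip2 s -> ~ R (f t)].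
suff [R [bR PR nPR]] : sep [::].
  exists R => // t; split=> [|/PR]; last exact.
  by move=> Rf; apply: contrapT => /nPR; apply.
apply: contrapT => nsep0.
have [s ns|z zP] := @dependent_choice _ (fun s => ~ sep s) nsep0.
  apply: contrapT => /forallNP sepS; apply: ns.
  have /choice[R RP] a := contrapT (sepS a).
  (* If every one-step extension by [(a, b)] were separable, a union over [a] of intersections over
     [b] would separate [s] itself. *)
  exists (\bigcup_a \bigcap_b R (a, b)); split=> [|t Pt ts|].
  - by apply: borel_bigcup => a; apply: borel_bigcap => b; case: (RP (a, b)).
  - exists (p t (size s)) => // b _; have [_ + _] := RP (p t (size s), b).
    by apply=> //; rewrite size_rcons mkseqS ts /unzip1 map_rcons.
  - move=> t Pt ts [a _ /(_ _ I)] /(_ (p t (size s))); have [_ _] := RP (a, p t (size s)).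
    by apply=> //; rewrite size_rcons mkseqS ts /unzip2 map_rcons.
(* An empty side would be separated trivially, by [set0] here and by [setT] below. *)
have near1 k : exists t, P t /\ agree k (p t) (fst \o z).
  apply: contrapT => /forallNP noP; apply: (zP k).
  exists set0; split=> [|t Pt|t _ _ []]; first exact: borel_set0.
  rewrite size_mkseq /unzip1 -map_comp => /agree_mkseq ?.
  by case: (noP t).
have near2 k : exists t, ~ P t /\ agree k (p t) (snd \o z).
  apply: contrapT => /forallNP noP; apply: (zP k).
  exists setT; split=> [|t _ _|t Pt] //; first exact: borel_setT.
  rewrite size_mkseq /unzip2 -map_comp => /agree_mkseq ?.
  by case: (noP t).
have [|t1 t1z] := complete (fst \o z).
  by move=> k; have [t []] := near1 k; exists t.
have [|t2 t2z] := complete (snd \o z).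
  by move=> k; have [t []] := near2 k; exists t.
have Pt1 : P t1.
  have [k kP] := Pcont t1; have [t [Pt]] := near1 k.
  by rewrite -t1z => /kP[+ _]; apply.
have Pt2 : ~ P t2.
  have [k kP] := Pcont t2; have [t [Pt]] := near2 k.
  by rewrite -t2z => /kP[_ +] => /contra_not; apply.
(* The two limits lie on different sides of [P], so their images differ at some [n]; by continuity
   the clopen set fixing this coordinate separates long enough cylinders. *)
have [n fn] : exists n, f t1 n <> f t2 n.
  apply: contrapT => /forallNP fE; apply/Pt2/(Pf t1) => //.
  by apply/funext => n; exact: contrapT (fE n).
have [k1 k1P] := fcont t1 n; have [k2 k2P] := fcont t2 n.
apply: (zP (maxn k1 k2)); exists [set y : baire | y n = f t1 n].
split=> [|t Pt|t Pt]; first exact: borel_eval.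
- rewrite size_mkseq /unzip1 -map_comp => /agree_mkseq/(agreeW (leq_maxl _ _)).
  by rewrite -t1z; exact: k1P.
- rewrite size_mkseq /unzip2 -map_comp => /agree_mkseq/(agreeW (leq_maxr _ _)).
  by rewrite -t2z /= => /k2P -> /esym.
Qed.

(** Defined on all of Baire space, not only on permutations, so that inversion is a Borel
    operator. *)
Definition baire_inv (h : baire) : baire := fun n => least (fun m => h m = n).

Lemma baire_invK (h : baire) :
  bijective h -> cancel h (baire_inv h) /\ cancel (baire_inv h) h.
Proof.
move=> [g hg gh]; have invK : cancel (baire_inv h) h.
  by move=> n; apply: (@leastP (fun m => h m = n)); exists (g n).
by split=> // n; apply: (can_inj hg); rewrite invK.
Qed.

Lemma baire_inv_eq (g h : baire) : cancel g h -> cancel h g -> baire_inv g = h.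
Proof.
move=> gh hg; apply/funext => n; apply: (can_inj gh); rewrite hg.
by apply: (baire_invK _).2; exists h.
Qed.

(** * Isomorphisms, their codes and atomic diagrams *)

Section isomorphisms.
Context {L : language}.
Implicit Types (M N P : structure L).

Lemma is_iso_inv M N (h : baire) : is_iso M N h -> is_iso N M (baire_inv h).
Proof.
move=> [bh rh fh]; have [hK invK] := baire_invK bh.
have mapK n (t : n.-tuple nat) : map_tuple h (map_tuple (baire_inv h) t) = t.
  by apply: val_inj; rewrite /= mapK.
split=> [|r t|f t]; first by exists h.
- by rewrite -rh mapK.
- by apply: (can_inj hK); rewrite invK -fh mapK.
Qed.

Definition iso_inv M N (h : iso M N) : iso N M := Iso_of (is_iso_inv (isoP h)).

Lemma isoK M N (h : iso M N) : cancel (iso_fun h) (iso_fun (iso_inv h)).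
Proof. by have [bh _ _] := isoP h; exact: (baire_invK bh).1. Qed.

Lemma isoVK M N (h : iso M N) : cancel (iso_fun (iso_inv h)) (iso_fun h).
Proof. by have [bh _ _] := isoP h; exact: (baire_invK bh).2. Qed.

Lemma iso_ext M N (g h : iso M N) : iso_fun g =1 iso_fun h -> g = h.
Proof. by move=> gh; apply: val_inj; apply/funext. Qed.

Lemma iso_compE M N P (g : iso N P) (h : iso M N) n :
  iso_fun (iso_comp g h) n = iso_fun g (iso_fun h n).
Proof. by []. Qed.

Lemma iso_invK M N (h : iso M N) : iso_inv (iso_inv h) = h.
Proof.
by apply: iso_ext => n; apply: (can_inj (isoK (iso_inv h))); rewrite isoVK isoK.
Qed.

Lemma iso_inv_comp M N P (g : iso N P) (h : iso M N) :
  iso_inv (iso_comp g h) = iso_comp (iso_inv h) (iso_inv g).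
Proof.
apply: iso_ext => n; apply: (can_inj (isoK (iso_comp g h))).
by rewrite isoVK !iso_compE !isoVK.
Qed.

(* Nested cylinders of permutations meet only if the inverses converge too. *)
Definition iso_code M N (h : iso M N) (n : nat) : nat * nat :=
  (iso_fun h n, iso_fun (iso_inv h) n).

Lemma agree_code M N M' N' (g : iso M N) (h : iso M' N') k :
  agree k (iso_code g) (iso_code h) <->
  agree k (iso_fun g) (iso_fun h) /\
  agree k (iso_fun (iso_inv g)) (iso_fun (iso_inv h)).
Proof.
split=> [gh|[gh gh'] i ik]; last by rewrite /iso_code gh // gh'.
by split=> i /gh[].
Qed.

(** Each cancellation equation involves only two entries of [x], and some isomorphism agrees with
    [x] at both. *)
Lemma code_limit (x : nat -> nat * nat) :
  (forall k, exists M N, exists h : iso M N, agree k (iso_code h) x) ->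
  cancel (fst \o x) (snd \o x) /\ cancel (snd \o x) (fst \o x).
Proof.
move=> xP; split=> n /=.
- have [M [N [h hx]]] := xP (maxn n (x n).1).+1.
  by rewrite -hx ?ltnS ?leq_maxr // -hx ?ltnS ?leq_maxl //=; exact: isoK.
- have [M [N [h hx]]] := xP (maxn n (x n).2).+1.
  by rewrite -hx ?ltnS ?leq_maxr // -hx ?ltnS ?leq_maxl //=; exact: isoVK.
Qed.

Lemma iso_code_eq M N (h : iso M N) (x : nat -> nat * nat) :
  cancel (fst \o x) (snd \o x) -> cancel (snd \o x) (fst \o x) ->
  iso_fun h =1 fst \o x -> iso_code h = x.
Proof.
move=> xK xVK hx; apply/funext => n; rewrite /iso_code [RHS]surjective_pairing.
congr pair; first exact: hx.
by apply: (can_inj (isoK h)); rewrite isoVK hx; have := xVK n.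
Qed.

Lemma agree_map_tuple n (t : n.-tuple nat) :
  exists k, forall g h : baire, agree k g h -> map_tuple g t = map_tuple h t.
Proof.
exists (\max_(i <- t) i).+1 => g h gh; apply: val_inj => /=.
by apply/eq_in_map => i it; apply: gh; rewrite ltnS; exact: leq_bigmax_seq.
Qed.

(** Preserving one relation or function value is a condition on finitely many values of the map, so
    it passes to the limit; bijectivity does because the inverses converge too. *)
Lemma iso_code_complete M N (x : nat -> nat * nat) :
  (forall k, exists h : iso M N, agree k (iso_code h) x) ->
  exists h : iso M N, iso_code h = x.
Proof.
move=> xP; have [|xK xVK] := @code_limit x.
  by move=> k; have [h hx] := xP k; exists M, N, h.
have xh k : exists h : iso M N, agree k (iso_fun h) (fst \o x).
  by have [h hx] := xP k; exists h => i ik; rewrite /= -hx.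
have xiso : is_iso M N (fst \o x).
  split=> [|r t|f t]; first by exists (snd \o x).
  - have [k kP] := agree_map_tuple t; have [h /kP <-] := xh k.
    by have [_ + _] := isoP h; apply.
  - have [k kP] := agree_map_tuple t.
    have [h hx] := xh (maxn k (fun_interp M t).+1).
    rewrite -(kP _ _ (agreeW (leq_maxl _ _) hx)) -hx ?leq_maxr //.
    by have [_ _] := isoP h; apply.
by exists (Iso_of xiso); apply: iso_code_eq.
Qed.

(** The image of [M] under a permutation [g] with inverse [h]; it turns any permutation into an
    isomorphism from [M]. *)
Definition push M (g h : nat -> nat) : structure L :=
  Structure (fun r t => rel_interp M (map_tuple h t) : bool)
            (fun f t => g (fun_interp M (map_tuple h t))).

Lemma push_iso M (g h : nat -> nat) :
  cancel g h -> cancel h g -> is_iso M (push M g h) g.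
Proof.
move=> gh hg; have mapK n (t : n.-tuple nat) : map_tuple h (map_tuple g t) = t.
  by apply: val_inj; rewrite /= mapK.
by split=> [|r t|f t]; [exists h|rewrite /= mapK|rewrite /= mapK].
Qed.

Lemma diagram_inj M N : diagram M = diagram N -> M = N.
Proof.
move=> MN; have {MN} sat (a : atomic L) : satisfies M a = satisfies N a.
  have := congr1 (fun d : baire => d (pickle a)) MN.
  by rewrite /diagram pickleK; do 2 case: (satisfies _ a).
case: M N sat => [rM fM] [rN fN] sat; congr Structure.
- apply: functional_extensionality_dep => r; apply/funext => t.
  exact: (sat (inl (Tagged _ t))).
- apply: functional_extensionality_dep => f; apply/funext => t.
  by have /= := sat (inr (Tagged _ (t, fM f t))); rewrite eqxx => /esym/eqP.
Qed.

(** Pulled back to [M], an atomic sentence depends on finitely many values of the inverse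
    isomorphism. This is the continuity required for Borel separation. *)
Lemma diagram_local M n : exists k, forall N (g : iso M N) N' (g' : iso M N'),
  agree k (iso_fun (iso_inv g')) (iso_fun (iso_inv g)) ->
  diagram N' n = diagram N n.
Proof.
rewrite /diagram; case: unpickle => [[[r t]|[f [t y]]]|]; last by exists 0.
- have [k kP] := agree_map_tuple t; exists k => N g N' g' /kP gg' /=.
  have [_ + _] := isoP (iso_inv g) => <-.
  by have [_ + _] := isoP (iso_inv g') => <-; rewrite gg'.
- have [k kP] := agree_map_tuple t; exists (maxn k y.+1) => N g N' g' gg' /=.
  have pull P (h : iso M P) : (fun_interp P t == y) =
      (fun_interp M (map_tuple (iso_fun (iso_inv h)) t) == iso_fun (iso_inv h) y).
    by have [_ _ ->] := isoP (iso_inv h); rewrite (inj_eq (can_inj (isoVK h))).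
  rewrite (pull _ g) (pull _ g') (kP _ _ (agreeW (leq_maxl _ _) gg')).
  by rewrite gg' ?leq_maxr.
Qed.

(** Separation is applied to all pairs of a structure [N] and an isomorphism from [M] to [N], mapped
    to the diagram of [N]. The property [Q] depends on [N] alone, hence on the diagram. *)
Lemma borel_iso_prefix M (s : seq (nat * nat)) :
  exists2 R, borel_set R & forall N : copy M,
    R (diagram N) <-> exists h : iso M N, mkseq (iso_code h) (size s) = s.
Proof.
pose p (t : {N & iso M N}) := iso_code (tagged t).
pose Q (t : {N & iso M N}) :=
  exists h : iso M (tag t), mkseq (iso_code h) (size s) = s.
have [x xP|[N g] n|t|[N g] [N' g']|R bR RP] :=
  @lusin_separation _ _ p (fun t => diagram (tag t)) Q.
- have [|xK xVK] := @code_limit x.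
    by move=> k; have [[N h] hx] := xP k; exists M, N, h.
  exists (Tagged (fun N => iso M N) (Iso_of (push_iso M xK xVK))).
  exact: iso_code_eq.
- have [k kP] := diagram_local M n; exists k => -[N' g'] /agree_code[_].
  exact: kP.
(* This [k] exceeds the first components in [s] and all its positions. There the inverses of [g] and
   [g'] agree, so composing [h] with the inverse of [g] and then with [g'] keeps the prefix [s]. *)
- pose k := (\max_(a <- s) maxn a.1 (size s)).+1.
  have transfer (N N' : structure L) (g : iso M N) (g' : iso M N') :
      agree k (iso_code g') (iso_code g) ->
      (exists h : iso M N, mkseq (iso_code h) (size s) = s) ->
      exists h : iso M N', mkseq (iso_code h) (size s) = s.
    move=> /agree_code[gg' gg'V] [h hs].
    exists (iso_comp g' (iso_comp (iso_inv g) h)); rewrite -[RHS]hs.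
    apply/agree_mkseq => i si; rewrite /iso_code.
    have hk : iso_fun h i < k /\ i < k.
      have hin : iso_code h i \in s.
        by rewrite -hs; apply/mapP; exists i; rewrite ?mem_iota.
      have := @leq_bigmax_seq _ s predT (fun a => maxn a.1 (size s)) _ hin isT.
      by rewrite geq_max /= => /andP[hi /(leq_trans si)/ltnW ?]; rewrite !ltnS.
    congr pair.
      by rewrite !iso_compE -gg'V ?isoVK //; case: hk.
    rewrite !iso_inv_comp iso_invK !iso_compE gg'V ?isoVK //.
    by case: hk.
  case: t => N g; exists k => -[N' g'] gg'; split.
    by apply: transfer; exact: agree_sym gg'.
  exact: transfer gg'.
- by rewrite /Q /= => /diagram_inj ->.
- exists R => // N; have [h hP] := copy_iso N.
  exact: (RP (Tagged (fun N => iso M N) (Iso_of hP))).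
Qed.

End isomorphisms.

(** * Borel choice of isomorphisms *)

Lemma borel_fun_inv (X : topologicalType) (b : X -> baire) (n : nat) :
  (forall m, borel_fun (fun x => b x m)) ->
  borel_fun (fun x => baire_inv (b x) n).
Proof. by move=> bb; apply: borel_least => m; exact: bb. Qed.

Lemma borel_iso_choice (L : language) (M : structure L) :
  exists2 b : baire -> baire, (forall n, borel_fun (fun x => b x n)) &
    (forall N : copy M, is_iso M N (b (diagram N))) /\ b (diagram M) = id.
Proof.
suff [b bb bP] : exists2 b : baire -> baire,
    (forall n, borel_fun (fun x => b x n)) &
    forall N : copy M, is_iso M N (b (diagram N)).
  exists (fun x => b x \o baire_inv (b (diagram M))) => [n|]; first exact: bb.
  have bM := bP (self_copy M).
  split=> [N|]; first exact: is_iso_comp (bP N) (is_iso_inv bM).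
  by apply/funext => n; have [bij _ _] := bM; exact: (baire_invK bij).2.
have /choice[R RP] s : exists R : set baire, borel_set R /\ forall N : copy M,
    R (diagram N) <-> exists h : iso M N, mkseq (iso_code h) (size s) = s.
  by have [R] := borel_iso_prefix M s; exists R.
pose dec n : nat * nat := odflt (0, 0) (unpickle n).
(* Of the entries that keep the prefix realizable, the one with the smallest code is taken; [dec]
   reaches every pair. *)
pose next x s := dec (least (fun n => R (rcons s (dec n)) x)).
have bgreedy n : borel_fun (fun x => greedy (next x) n).
  elim: n => [|n IH]; first exact: borel_fun_cst.
  apply: (borel_fun_bind (g := fun s x => rcons s (next x s)) IH) => s.
  apply: (borel_fun_comp (fun n => rcons s (dec n))).
  by apply: borel_least => m; exact: (RP _).1.
pose b x : baire := fun n => (next x (greedy (next x) n)).1.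
exists b => [n|N].
  apply: (borel_fun_bind (g := fun s x => (next x s).1) (bgreedy n)) => s.
  apply: (borel_fun_comp (fun n => (dec n).1)).
  by apply: borel_least => m; exact: (RP _).1.
set x := diagram N.
(* An isomorphism realizing the prefix of length [n] supplies a candidate for the next entry, so the
   greedy choice never gets stuck. *)
have prefix n : exists h : iso M N, mkseq (iso_code h) n = greedy (next x) n.
  elim: n => [|n [h hn]].
    by have [h hP] := copy_iso N; exists (Iso_of hP).
  have sn : size (greedy (next x) n) = n by rewrite -hn size_mkseq.
  have : R (greedy (next x) n.+1) x.
    apply: (@leastP (fun k => R (rcons (greedy (next x) n) (dec k)) x)).
    exists (pickle (iso_code h n)); apply/(RP _).2; exists h.
    by rewrite size_rcons sn mkseqS /dec pickleK hn.
  by move/(RP _).2 => [g]; rewrite size_rcons sn; exists g.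
have [|h hx] := @iso_code_complete _ M N (fun n => next x (greedy (next x) n)).
  by move=> k; have [h hk] := prefix k; exists h;
    apply/agree_mkseq; rewrite hk greedyE.
suff <- : iso_fun h = b x by exact: isoP.
by apply/funext => n; rewrite /b -(congr1 (fun c => c n) hx).
Qed.

(** * Borel extensions of maps between automorphism groups *)

Section homomorphisms.
Context {LA LB : language} {A : structure LA} {B : structure LB}.

(** At an automorphism exactly one [m] qualifies for each [n], so the least one is the right
    value. *)
Lemma borel_extension (K : aut B -> aut A) :
  (forall n m, exists2 R, borel_set R &
    forall g : aut B, R (iso_fun g) <-> iso_fun (K g) n = m) ->
  exists2 Phi : baire -> baire, borel_operator Phi &
    forall g : aut B, Phi (iso_fun g) = iso_fun (K g).
Proof.
move=> KR; have /choice[R RP] a : exists R : set baire, borel_set R /\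
    forall g : aut B, R (iso_fun g) <-> iso_fun (K g) a.1 = a.2.
  by have [R] := KR a.1 a.2; exists R.
exists (fun x n => least (fun m => R (n, m) x)) => [|g].
  by apply: borel_operator_baire => n; apply: borel_least => m; exact: (RP _).1.
apply/funext => n; apply/esym/(RP (n, _)).2.
apply: (@leastP (fun m => R (n, m) (iso_fun g))).
by exists (iso_fun (K g) n); apply/(RP _).2.
Qed.

Lemma continuous_trace (H : aut B -> aut A) : continuous H -> forall n m,
  exists2 V, open V & forall g : aut B, V (iso_fun g) <-> iso_fun (H g) n = m.
Proof.
move=> /continuousP Hc n m.
have [V oV VE] : open (H @^-1` [set g | iso_fun g n = m]).
  by apply: Hc; exists [set x : baire | x n = m] => //; exact: open_eval.
by exists V => // g; have := congr1 (fun U : set (aut B) => U g) VE => /= <-.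
Qed.

(** Injectivity of [H] makes the condition on [g] a condition on its image; the separating set is
    then read at [H (K g) = g]. *)
Lemma borel_inverse_trace (H : aut B -> aut A) (K : aut A -> aut B) :
  continuous H -> cancel H K -> cancel K H -> forall n m,
  exists2 R, borel_set R &
    forall g : aut A, R (iso_fun g) <-> iso_fun (K g) n = m.
Proof.
move=> Hc HK KH n m.
have [|g j|g|g g' gg'|R bR RP] := @lusin_separation _ _ (@iso_code _ B B)
    (fun g => iso_fun (H g)) (fun g => iso_fun g n = m).
- exact: iso_code_complete.
- have [V oV VP] := continuous_trace Hc j (iso_fun (H g) j).
  have [k kV] := open_agree oV ((VP g).2 erefl).
  by exists k => g' /agree_code[/kV/VP].
- by exists n.+1 => g' /agree_code[gg' _]; rewrite gg'.
- by have /(can_inj HK)-> : H g = H g' by apply: iso_ext => i; rewrite gg'.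
- by exists R => // g; have := RP (K g); rewrite KH.
Qed.

End homomorphisms.

(** * The equivalence *)

Section collapse.
Context {LA LB : language} {A : structure LA} {B : structure LB}.
Variables (K : aut B -> aut A) (b : forall M : copy B, iso B M).
Hypothesis Kmorph : {morph K : g h / iso_comp g h >-> iso_comp g h}.

Definition transport (M N : copy B) (h : iso M N) : aut B :=
  iso_comp (iso_inv (b N)) (iso_comp h (b M)).

Lemma morph_iso_id : K (iso_id B) = iso_id A.
Proof.
apply: iso_ext => n; apply: (can_inj (isoK (K (iso_id B)))).
(* The image of the identity is idempotent, and it cancels. *)
by rewrite -iso_compE -Kmorph; congr (iso_fun (K _) n); exact: iso_ext.
Qed.

Lemma transport_id (M : copy B) : transport (iso_id M) = iso_id B.
Proof. by apply: iso_ext => n; exact: isoK. Qed.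

Lemma transport_comp (M N P : copy B) (g : iso N P) (h : iso M N) :
  transport (iso_comp g h) = iso_comp (transport g) (transport h).
Proof. by apply: iso_ext => n; rewrite !iso_compE isoVK. Qed.

Lemma collapse_id (M : copy B) : K (transport (iso_id M)) = iso_id A.
Proof. by rewrite transport_id morph_iso_id. Qed.

Lemma collapse_comp (M N P : copy B) (g : iso N P) (h : iso M N) :
  K (transport (iso_comp g h)) = iso_comp (K (transport g)) (K (transport h)).
Proof. by rewrite transport_comp Kmorph. Qed.

Definition collapse : functor B A :=
  @Functor LA LB B A (fun=> self_copy A)
    (fun M N (h : iso M N) => K (transport h)) collapse_id collapse_comp.

Lemma borel_collapse (beta : baire -> baire) (Phi : baire -> baire) :
  (forall n, borel_fun (fun x => beta x n)) ->
  (forall M, iso_fun (b M) = beta (diagram M)) ->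
  borel_operator Phi -> (forall g : aut B, Phi (iso_fun g) = iso_fun (K g)) ->
  borel_functor collapse.
Proof.
move=> bbeta bE bPhi PhiE; split.
  exists (fun=> diagram A) => //; apply: borel_operator_baire => n.
  exact: borel_fun_cst.
(* This is [transport] on codes. Its intermediate values are numbers, so each evaluation can be
   split over countably many cases. *)
pose tr (p : baire * baire * baire) : baire := fun n =>
  baire_inv (beta p.2) (p.1.2 (beta p.1.1 n)).
have btr : borel_operator tr.
  have b1 : borel_operator (fun p : baire * baire * baire => p.1.1).
    apply: continuous_borel => p; apply: (@cvg_comp _ _ _ fst fst _ (nbhs p.1)).
      exact: cvg_fst.
    by case: p => -[x y] z; exact: cvg_fst.
  have b2 : borel_operator (fun p : baire * baire * baire => p.1.2).
    apply: continuous_borel => p; apply: (@cvg_comp _ _ _ fst snd _ (nbhs p.1)).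
      exact: cvg_fst.
    by case: p => -[x y] z; exact: cvg_snd.
  have b3 : borel_operator (fun p : baire * baire * baire => p.2).
    by apply: continuous_borel => p; exact: cvg_snd.
  apply: borel_operator_baire => n.
  apply: (borel_fun_bind (f := fun p : baire * baire * baire => beta p.1.1 n)
    (g := fun k p => baire_inv (beta p.2) (p.1.2 k))) => [|k].
    exact: borel_fun_preimage b1 (bbeta n).
  apply: (borel_fun_bind (f := fun p : baire * baire * baire => p.1.2 k)
    (g := fun l p => baire_inv (beta p.2) l)) => [|l].
    exact: borel_fun_preimage b2 (borel_eval k).
  by apply: borel_fun_inv => m; exact: borel_fun_preimage b3 (bbeta m).
exists (Phi \o tr) => [U bU|M N h]; first exact: btr (bPhi _ bU).
rewrite /= -PhiE; congr Phi; apply/funext => n.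
by rewrite /tr /= -!bE.
Qed.

End collapse.

Theorem theorem2p5 (LA LB : language) (A : structure LA) (B : structure LB)
    (H : aut B -> aut A) :
  group_isomorphism H -> continuous H ->
  exists E : adjoint_equivalence B A,
    [/\ borel_adjoint_equivalence E,
        eqF E (self_copy B) = A :> structure LA
      & forall h : aut B,
          fmor (eqF E) (h : iso (self_copy B) (self_copy B)) = H h :> baire].
Proof.
move=> [[K HK KH] Hmorph] Hc.
have Kmorph : {morph K : g h / iso_comp g h >-> iso_comp g h}.
  by move=> g h; apply: (can_inj HK); rewrite Hmorph !KH.
have [alpha balpha [alphaP alpha1]] := borel_iso_choice A.
have [beta bbeta [betaP beta1]] := borel_iso_choice B.
have [PhiH bPhiH PhiHE] : exists2 Phi : baire -> baire, borel_operator Phi &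
    forall g : aut B, Phi (iso_fun g) = iso_fun (H g).
  apply: borel_extension => n m; have [V oV VP] := continuous_trace Hc n m.
  by exists V => //; exact: borel_open.
have [PhiK bPhiK PhiKE] := borel_extension (borel_inverse_trace Hc HK KH).
pose a (M : copy A) := Iso_of (alphaP M); pose b (M : copy B) := Iso_of (betaP M).
have a1 : a (self_copy A) = iso_id A.
  by apply: iso_ext => n; exact: (congr1 (fun f : baire => f n) alpha1).
have b1 : b (self_copy B) = iso_id B.
  by apply: iso_ext => n; exact: (congr1 (fun f : baire => f n) beta1).
have inv1 (L : language) (M : structure L) : iso_inv (iso_id M) = iso_id M.
  by apply: iso_ext => n; apply: (isoVK (iso_id M)).
pose F := collapse b Hmorph; pose G := collapse a Kmorph.
pose eps (M : copy A) : iso M (F (G M)) := iso_inv (a M).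
pose eta (M : copy B) : iso M (G (F M)) := iso_inv (b M).
(* At the base copies the chosen isomorphisms are identities. Hence [F] extends [H], and the double
   image of a morphism reduces to a single transport. *)
have tra (h : aut A) : transport a (h : iso (self_copy A) (self_copy A)) = h.
  by apply: iso_ext => n; rewrite /transport a1 inv1.
have trb (h : aut B) : transport b (h : iso (self_copy B) (self_copy B)) = h.
  by apply: iso_ext => n; rewrite /transport b1 inv1.
have Enat (M N : copy A) (h : iso M N) :
    iso_comp (fmor F (fmor G h)) (eps M) = iso_comp (eps N) h.
  by rewrite /= trb KH; apply: iso_ext => n; rewrite !iso_compE isoVK.
have Hnat (M N : copy B) (h : iso M N) :
    iso_comp (fmor G (fmor F h)) (eta M) = iso_comp (eta N) h.
  by rewrite /= tra HK; apply: iso_ext => n; rewrite !iso_compE isoVK.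
(* Both sides are the identity of [A]: transporting [eta M] cancels [b M] against its inverse, and
   [eps] is trivial at the base copy. *)
have Feta (M : copy B) : fmor F (eta M) = eps (F M).
  rewrite /eps /= a1 inv1 -(morph_iso_id Hmorph); congr H.
  by apply: iso_ext => n; rewrite /transport b1 inv1 /eta !iso_compE isoK.
have Geps (M : copy A) : fmor G (eps M) = eta (G M).
  rewrite /eta /= b1 inv1 -(morph_iso_id Kmorph); congr K.
  by apply: iso_ext => n; rewrite /transport a1 inv1 /eps !iso_compE isoK.
exists (AdjointEquivalence Enat Hnat Feta Geps); split=> //=; last first.
  by move=> h; rewrite trb.
split=> /=.
- exact: borel_collapse bbeta _ bPhiH PhiHE.
- exact: borel_collapse balpha _ bPhiK PhiKE.
- exists (fun x => baire_inv (alpha x)) => //.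
  by apply: borel_operator_baire => n; exact: borel_fun_inv.
- exists (fun x => baire_inv (beta x)) => //.
  by apply: borel_operator_baire => n; exact: borel_fun_inv.
Qed.
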